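(* In the setting of the context, suppose the regularity assumption and the local worst-case oracle assumption hold, and fix $x\in\mathcal X$ (write $\ell_k(z)=\ell_k(x,z)$). Then for each $i\in[N]$ the function $b\mapsto V_i(b)$ is concave on $\mathbb R_+$, where $V_i(b)=\max_{1\le k_1<k_2\le K}V_i^{(k_1,k_2)}(b)$ is the local utility defined in the context.
   Context: Notation: $[n]=\{1,\dots,n\}$; $\mathcal P(\mathcal Z)$ is the set of Borel probability measures on $\mathcal Z$. Setting. $\mathcal X\subseteq\mathbb R^n$, $\mathcal Z\subseteq\mathbb R^m$. A transportation cost $c:\mathcal Z\times\mathcal Z\to\mathbb R_+$ is lower semicontinuous, satisfies $c(z,z)=0$ for all $z$, and $c(\cdot,\hat z)$ is convex for every fixed $\hat z\in\mathcal Z$. The optimal transport discrepancy is $\mathrm{OT}_c(\mathbb P,\mathbb Q)=\min_{\gamma}\mathbb E_{(z,\hat z)\sim\gamma}[c(z,\hat z)]$ over couplings $\gamma$ of $\mathbb P$ and $\mathbb Q$. Given $\hat z_1,\dots,\hat z_N\in\mathcal Z$, let $\hat{\mathbb P}=\frac1N\sum_{i=1}^N\delta_{\hat z_i}$; given $\rho>0$, let $\mathcal P=\{\mathbb P\in\mathcal P(\mathcal Z):\mathrm{OT}_c(\mathbb P,\hat{\mathbb P})\le\rho\}$. Regularity assumption. (i) $\mathcal X$ is nonempty and convex; there exist $\mathbb Q_0\in\mathcal P$ and $x_0\in\mathcal X$ such that $x\mapsto\mathbb E_{z\sim\mathbb Q_0}[\ell(x,z)]$ is inf-compact on $\mathcal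 X$ (all sublevel sets are compact) and $\mathbb E_{z\sim\mathbb Q_0}[\ell(x_0,z)]>-\infty$; $\mathcal Z$ is nonempty, closed and convex. (ii) $\ell(x,z)=\max_{k\in[K]}\ell_k(x,z)$ with $K\ge2$, where each $\ell_k:\mathbb R^n\times\mathbb R^m\to\mathbb R$ is real-valued, convex in its first and concave in its second argument. (iii) There exist a norm $\|\cdot\|$ on $\mathbb R^m$ and $p\ge1$ with $c(z,\hat z)\ge\|z-\hat z\|^p$ for all $z,\hat z\in\mathcal Z$; moreover, if $p=1$, then for every $x\in\mathcal X$ there exist $g>0$, $\hat z_0\in\mathcal Z$ and $r\in[0,1)$ such that $\ell(x,z)\le g[1+\|z-\hat z_0\|^r]$ for all $z\in\mathcal Z$. Local worst-case oracle assumption. For any $k\in[K]$, $\hat z\in\mathcal Z$, radius $u\ge0$ and accuracy $\epsilon>0$ there is an algorithm that returns $\hat v\in\mathbb R^m$ with $\hat z+\hat v\in\mathcal Z$, $c(\hat z+\hat v,\hat z)\le u$, together with $\hat L=\ell_k(\hat z+\hat v)\ge\max\{\ell_k(\hat z+v):v\in\mathbb R^m,\hat z+v\in\mathcal Z,c(\hat z+v,\hat z)\le u\}-\epsilon$. Local utilities. $V_i^{(k_1,k_2)}(b)$ is the maximum of $\alpha_1\ell_{k_1}(\hat z_i+v_1)+\alpha_2\ell_{k_2}(\hat z_i+v_2)$ over $\alpha_j,\beta_j\in\mathbb R_+$, $v_j\in\mathbb R^m$ with $\hat z_i+v_j\in\mathcal Z$, $\alpha_jc(\hat z_i+v_j,\hat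 z_i)\le\beta_j$ ($j=1,2$), $\alpha_1+\alpha_2=1$, $\beta_1+\beta_2=b$. *)

(* Defs.v *)
From HB Require Import structures.
From mathcomp Require Import all_boot all_order all_algebra.
From mathcomp Require Import all_classical all_reals all_analysis.

Set Implicit Arguments.
Unset Strict Implicit.
Unset Printing Implicit Defensive.

Import Order.TTheory GRing.Theory Num.Theory.
Import numFieldNormedType.Exports.

Local Open Scope classical_set_scope.
Local Open Scope ring_scope.
Local Open Scope convex_scope.

(* Vectors of R^n are row vectors 'rV[R]_n.  Functions whose domain is a subset
   of R^n are total functions, constrained only on that subset. *)

Definition concave_function (R : numFieldType) (E : lmodType R)
    (E' := convex_lmodType E) (D : set E') (f : E' -> R^o) :=
  forall t : {i01 R},
    {in D &, forall x y : E', (f x <| t |> f y <= f (x <| t |> y))%R}.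

Record is_norm (R : realType) (m : nat) (nm : 'rV[R]_m -> R) : Prop := {
  is_norm_triangle : forall v w, nm (v + w) <= nm v + nm w ;
  is_norm_homogeneous : forall (a : R) v, nm (a *: v) = `|a| * nm v ;
  is_norm_definite : forall v, nm v = 0 -> v = 0 }.

Definition is_max (R : realType) (S : set R) (v : R) : Prop :=
  S v /\ ubound S v.

Definition borelRV (R : realType) (m : nat) :=
  g_sigma_algebraType (@open 'rV[R]_m).

Section optimal_transport.
Variables (R : realType) (m : nat).
Implicit Types (Z : set 'rV[R]_m) (c : 'rV[R]_m -> 'rV[R]_m -> R).

Record transportation_cost Z c : Prop := {
  cost_ge0 : forall z zh, Z z -> Z zh -> 0 <= c z zh ;
  cost_lsc : lower_semicontinuous
    ((fun w => (c w.1 w.2)%:E) : subspace (Z `*` Z) -> \bar R) ;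
  cost_refl : forall z, Z z -> c z z = 0 ;
  cost_convex : forall zh, Z zh -> convex_function Z (c ^~ zh) }.

Definition couplings (P Q : set (borelRV R m) -> \bar R) :
    set (probability (borelRV R m * borelRV R m)%type R) :=
  [set g | forall A, measurable A ->
     g (A `*` setT) = P A /\ g (setT `*` A) = Q A].

(* The integral is restricted to Z `*` Z, where c is prescribed; every coupling
   of two probability measures carried by the closed set Z is carried by
   Z `*` Z. *)
Definition OT Z c (P Q : set (borelRV R m) -> \bar R) : \bar R :=
  ereal_inf [set (\int[g]_(w in Z `*` Z) (c w.1 w.2)%:E)%E | g in couplings P Q].

Definition empirical N (zhat : 'I_N -> 'rV[R]_m) (A : set (borelRV R m)) :
    \bar R :=
  ((N%:R^-1)%:E * \sum_(i < N) \d_(zhat i : borelRV R m) A)%E.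

(* Borel probability measures on the closed set Z are represented by the Borel
   probability measures on R^m that give Z mass one. *)
Definition ambiguity_set Z c N (zhat : 'I_N -> 'rV[R]_m) (rho : R) :
    set (probability (borelRV R m) R) :=
  [set Q | Q Z = 1%E /\ (OT Z c Q (empirical zhat) <= rho%:E)%E].

End optimal_transport.

Section loss.
Variables (R : realType) (n m K : nat).
Implicit Types (X : set 'rV[R]_n) (Z : set 'rV[R]_m).
Implicit Types (c : 'rV[R]_m -> 'rV[R]_m -> R).
Implicit Types (ell : 'I_K -> 'rV[R]_n -> 'rV[R]_m -> R).

(* For K > 0 the set is finite and nonempty, so that sup is the maximum. *)
Definition loss ell (x : 'rV[R]_n) (z : 'rV[R]_m) : R :=
  sup [set ell k x z | k in [set: 'I_K]].

Definition inf_compact_on X (f : 'rV[R]_n -> \bar R) : Prop :=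
  forall t : R, compact [set x | X x /\ (f x <= t%:E)%E].

Definition expected_loss ell (Q : probability (borelRV R m) R)
    (x : 'rV[R]_n) : \bar R :=
  'E_Q[fun z : borelRV R m => loss ell x z].

Record regularity X Z c N (zhat : 'I_N -> 'rV[R]_m) (rho : R) ell : Prop := {
  X_nonempty : X !=set0 ;
  X_convex : convex_set X ;
  expected_loss_inf_compact : exists Q0 x0,
    [/\ ambiguity_set Z c zhat rho Q0, X x0,
        inf_compact_on X (expected_loss ell Q0)
      & (-oo < expected_loss ell Q0 x0)%E] ;
  Z_nonempty : Z !=set0 ;
  Z_closed : closed Z ;
  Z_convex : convex_set Z ;
  K_ge2 : (2 <= K)%N ;
  ell_convex : forall k z, convex_function setT ((ell k) ^~ z) ;
  ell_concave : forall k x, concave_function setT (ell k x) ;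
  cost_growth : exists nm p,
    [/\ is_norm nm, 1 <= p,
        forall z zh, Z z -> Z zh -> nm (z - zh) `^ p <= c z zh
      & p = 1 -> forall x, X x -> exists g zh0 r,
          [/\ 0 < g, Z zh0, 0 <= r < 1
            & forall z, Z z -> loss ell x z <= g * (1 + nm (z - zh0) `^ r)]] }.

End loss.

Section local_problems.
Variables (R : realType) (m K : nat).
Variables (Z : set 'rV[R]_m) (c : 'rV[R]_m -> 'rV[R]_m -> R).
Variable f : 'I_K -> 'rV[R]_m -> R.

(* Only the input-output specification of the algorithm is expressed. *)
Definition local_worst_case_oracle : Prop :=
  exists oracle : 'I_K -> 'rV[R]_m -> R -> R -> 'rV[R]_m * R,
  forall k zh u eps, Z zh -> 0 <= u -> 0 < eps ->
    let: (vh, Lh) := oracle k zh u eps in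
    [/\ Z (zh + vh), c (zh + vh) zh <= u, Lh = f k (zh + vh)
      & sup [set f k (zh + v) | v in
               [set v | Z (zh + v) /\ c (zh + v) zh <= u]] - eps <= Lh].

Definition pair_values (zh : 'rV[R]_m) (k1 k2 : 'I_K) (b : R) : set R :=
  [set s | exists a1 a2 b1 b2 v1 v2,
     [/\ [/\ 0 <= a1, 0 <= a2, 0 <= b1 & 0 <= b2],
         Z (zh + v1) /\ Z (zh + v2),
         a1 * c (zh + v1) zh <= b1 /\ a2 * c (zh + v2) zh <= b2,
         a1 + a2 = 1 /\ b1 + b2 = b
       & s = a1 * f k1 (zh + v1) + a2 * f k2 (zh + v2)]].

Definition pair_utility (zh : 'rV[R]_m) (k1 k2 : 'I_K) (b : R) : R :=
  sup (pair_values zh k1 k2 b).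

(* For K > 1 the set is finite and nonempty, so that sup is the maximum. *)
Definition local_utility (zh : 'rV[R]_m) (b : R) : R :=
  sup [set s | exists k1 k2 : 'I_K,
         (k1 < k2)%N /\ s = pair_utility zh k1 k2 b].

End local_problems.

(* Main.v *)
(** At a fixed budget, a pair (k1, k2) spends its mass on two points of Z, each
    seen only through its cost and its utility.  A mixture of two optimal such
    allocations is a measure with four atoms; a basic feasible solution of the
    linear program in the weights has at most two atoms, the same mean cost and
    no smaller mean utility.  Two atoms of the same piece merge because ell_k is
    concave and the cost convex, so the mixture is dominated by a single pair.

    For attainment, an atom of vanishing mass a may escape to infinity.  As the
    pieces grow sublinearly in the cost, its limiting contribution is at most
    zero; hence the hypographs of the perspectives
    (a, s) |-> max {a * ell_k z | a * c z <= s} are closed, and the pair problem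
    becomes the maximization of a continuous function on a compact set. *)
Require Import Defs.
From HB Require Import structures.
From mathcomp Require Import all_boot all_order all_algebra.
From mathcomp Require Import all_classical all_reals all_analysis.
From mathcomp Require Import ring lra.

Import Order.TTheory GRing.Theory Num.Theory.
Import numFieldNormedType.Exports.

Local Open Scope classical_set_scope.
Local Open Scope ring_scope.

Set Implicit Arguments.
Unset Strict Implicit.

Lemma ratio_test (R : realFieldType) (I : finType) (w d : I -> R) :
  (forall i, 0 <= w i) -> (exists i, d i < 0) ->
  exists2 t, 0 <= t &
    (forall i, 0 <= w i + t * d i) /\ exists i, w i + t * d i = 0.
Proof.
move=> w0 [i0 di0].
case: (@arg_minP _ _ _ i0 (fun i => d i < 0) (fun i => w i / - d i) di0) => j dj jmin.
have wj0 : 0 <= w j / - d j by rewrite divr_ge0// oppr_ge0 ltW.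
exists (w j / - d j) => //; split => [i|]; last first.
  by exists j; rewrite invrN mulrN mulNr divfK ?subrr// lt_eqF.
have [di|di] := ltP (d i) 0; last by rewrite addr_ge0// mulr_ge0.
have := jmin _ di; rewrite ler_pdivlMr ?oppr_gt0// => h; lra.
Qed.

(* The weights move along a direction that keeps the total mass and the mean of
   the first coordinates and does not decrease the mean of the second ones,
   until one of them vanishes. *)
Lemma three_to_two_atoms (R : realFieldType) (D : set (R * R))
    (P1 P2 P3 : R * R) (w1 w2 w3 : R) :
  D P1 -> D P2 -> D P3 -> 0 <= w1 -> 0 <= w2 -> 0 <= w3 ->
  exists P Q a b, [/\ [/\ D P, D Q, 0 <= a & 0 <= b],
    a + b = w1 + w2 + w3,
    a * P.1 + b * Q.1 = w1 * P1.1 + w2 * P2.1 + w3 * P3.1 &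
    w1 * P1.2 + w2 * P2.2 + w3 * P3.2 <= a * P.2 + b * Q.2].
Proof.
case: P1 P2 P3 => c1 f1 [c2 f2] [c3 f3] D1 D2 D3 w10 w20 w30.
have [d1 [d2 [d3 [ds dc df dneg]]]] : exists d1 d2 d3 : R,
    [/\ d1 + d2 + d3 = 0, d1 * c1 + d2 * c2 + d3 * c3 = 0,
        0 <= d1 * f1 + d2 * f2 + d3 * f3 &
        [\/ d1 < 0, d2 < 0 | d3 < 0]].
  have signed (d1 d2 d3 : R) : d1 + d2 + d3 = 0 ->
      d1 * c1 + d2 * c2 + d3 * c3 = 0 -> d1 != 0 \/ d2 != 0 ->
      exists d1 d2 d3 : R,
        [/\ d1 + d2 + d3 = 0, d1 * c1 + d2 * c2 + d3 * c3 = 0,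
          0 <= d1 * f1 + d2 * f2 + d3 * f3 &
          [\/ d1 < 0, d2 < 0 | d3 < 0]].
    move=> ds dc dn0.
    have [h|h] := leP 0 (d1 * f1 + d2 * f2 + d3 * f3).
      exists d1, d2, d3; split=> //.
      have [?|h1] := ltP d1 0; first exact: Or31.
      have [?|h2] := ltP d2 0; first exact: Or32.
      by apply: Or33; case: dn0 => /eqP ?; lra.
    exists (- d1), (- d2), (- d3); split; [lra|lra|lra|].
    have [?|h1] := ltP (- d1) 0; first exact: Or31.
    have [?|h2] := ltP (- d2) 0; first exact: Or32.
    by apply: Or33; case: dn0 => /eqP ?; lra.
  have [c23|c23] := eqVneq (c2 - c3) 0; last first.
    by apply: (signed (c2 - c3) (c3 - c1) (c1 - c2)); [ring|ring|left].
  have [c31|c31] := eqVneq (c3 - c1) 0; last first.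
    by apply: (signed (c2 - c3) (c3 - c1) (c1 - c2)); [ring|ring|right].
  apply: (signed 1 (-1) 0); [ring| |left; exact: oner_neq0].
  by lra.
pose w i := if i is Some j then if j then w1 else w2 else w3.
pose d i := if i is Some j then if j then d1 else d2 else d3.
have [| |t t0 [wt [i ti]]] := @ratio_test R (option bool) w d.
- by case=> [[]|].
- case: dneg => ?; [by exists (Some true)|by exists (Some false)|by exists None].
have := wt (Some true); have := wt (Some false); have := wt None.
rewrite /w /d => h3 h2 h1.
have tdf : 0 <= t * (d1 * f1 + d2 * f2 + d3 * f3) by rewrite mulr_ge0.
have tdc : t * (d1 * c1 + d2 * c2 + d3 * c3) = 0 by rewrite dc mulr0.
have tds : t * (d1 + d2 + d3) = 0 by rewrite ds mulr0.
have {}ti : [\/ w1 + t * d1 = 0, w2 + t * d2 = 0 | w3 + t * d3 = 0].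
  by case: i ti => [[]|] ?; [exact: Or31|exact: Or32|exact: Or33].
case: ti => ti.
- exists (c2, f2), (c3, f3), (w2 + t * d2), (w3 + t * d3); split=> //=.
  + by lra.
  + have : (w1 + t * d1) * c1 = 0 by rewrite ti mul0r.
    by lra.
  + have : (w1 + t * d1) * f1 = 0 by rewrite ti mul0r.
    by lra.
- exists (c1, f1), (c3, f3), (w1 + t * d1), (w3 + t * d3); split=> //=.
  + by lra.
  + have : (w2 + t * d2) * c2 = 0 by rewrite ti mul0r.
    by lra.
  + have : (w2 + t * d2) * f2 = 0 by rewrite ti mul0r.
    by lra.
- exists (c1, f1), (c2, f2), (w1 + t * d1), (w2 + t * d2); split=> //=.
  + by lra.
  + have : (w3 + t * d3) * c3 = 0 by rewrite ti mul0r.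
    by lra.
  + have : (w3 + t * d3) * f3 = 0 by rewrite ti mul0r.
    by lra.
Qed.

Lemma four_to_two_atoms (R : realFieldType) (D : set (R * R))
    (P1 P2 P3 P4 : R * R) (w1 w2 w3 w4 : R) :
  D P1 -> D P2 -> D P3 -> D P4 ->
  0 <= w1 -> 0 <= w2 -> 0 <= w3 -> 0 <= w4 ->
  exists P Q a b, [/\ [/\ D P, D Q, 0 <= a & 0 <= b],
    a + b = w1 + w2 + w3 + w4,
    a * P.1 + b * Q.1 = w1 * P1.1 + w2 * P2.1 + w3 * P3.1 + w4 * P4.1 &
    w1 * P1.2 + w2 * P2.2 + w3 * P3.2 + w4 * P4.2 <= a * P.2 + b * Q.2].
Proof.
move=> D1 D2 D3 D4 w10 w20 w30 w40.
have [P [Q [a [b [[DP DQ a0 b0] ab abc abf]]]]] :=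
  three_to_two_atoms D1 D2 D3 w10 w20 w30.
have [P' [Q' [a' [b' [[DP' DQ' a'0 b'0] ab' abc' abf']]]]] :=
  three_to_two_atoms DP DQ D4 a0 b0 w40.
by exists P', Q', a', b'; split=> //; lra.
Qed.

Lemma concave_functionE (R : realType) (E : lmodType R) (D : set E) (f : E -> R)
    (a b : R) (x y : E) :
  @concave_function R E D f -> D x -> D y -> 0 <= a -> 0 <= b -> a + b = 1 ->
  a * f x + b * f y <= f (a *: x + b *: y).
Proof.
move=> cf Dx Dy a0 b0 ab.
have a1 : a <= 1 by lra.
have -> : b = 1 - a by lra.
by have := cf (Itv01 a0 a1) x y (mem_set Dx) (mem_set Dy).
Qed.

Lemma convex_functionE (R : realType) (E : lmodType R) (D : set E) (f : E -> R)
    (a b : R) (x y : E) :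
  @convex_function R E D f -> D x -> D y -> 0 <= a -> 0 <= b -> a + b = 1 ->
  f (a *: x + b *: y) <= a * f x + b * f y.
Proof.
move=> cf Dx Dy a0 b0 ab.
have a1 : a <= 1 by lra.
have -> : b = 1 - a by lra.
by have := cf (Itv01 a0 a1) x y (mem_set Dx) (mem_set Dy).
Qed.

Lemma convex_setE (R : realType) (E : lmodType R) (D : set E) (a b : R)
    (x y : E) :
  @convex_set R E D -> D x -> D y -> 0 <= a -> 0 <= b -> a + b = 1 ->
  D (a *: x + b *: y).
Proof.
move=> cD Dx Dy a0 b0 ab.
have a1 : a <= 1 by lra.
have -> : b = 1 - a by lra.
by have /set_mem := cD x y (Itv01 a0 a1) (mem_set Dx) (mem_set Dy).
Qed.

Section concave_rV.
Variables (R : realType) (m : nat) (f : 'rV[R]_m -> R).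
Hypothesis cf : concave_function setT f.

Lemma concave_ge_on_box (I : Type) (s : seq I) (e : I -> 'rV[R]_m) x :
  exists M, forall a : I -> R, (forall i, `|a i| <= 1) ->
    M <= f (x + \sum_(i <- s) a i *: e i).
Proof.
elim: s x => [|i s IH] x.
  by exists (f x) => a _; rewrite big_nil addr0.
have [M1 hM1] := IH (x + e i); have [M2 hM2] := IH (x - e i).
exists (Num.min M1 M2) => a a1; rewrite big_cons.
have := a1 i; rewrite ler_norml => /andP[ai1 ai2].
set S := \sum_(j <- s) _.
pose p := (1 + a i) / 2; pose q := (1 - a i) / 2.
have -> : x + (a i *: e i + S) =
    p *: (x + e i + S) + q *: (x - e i + S).
  apply/rowP => j; rewrite !mxE /p /q; lra.
apply: le_trans (concave_functionE cf _ _ _ _ _) => //; rewrite /p /q; try lra.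
have h1 : Num.min M1 M2 <= f (x + e i + S).
  by apply: le_trans (hM1 a a1); rewrite ge_min lexx.
have h2 : Num.min M1 M2 <= f (x - e i + S).
  by apply: le_trans (hM2 a a1); rewrite ge_min lexx orbT.
have p1 : 0 <= (1 + a i) / 2 by lra.
have p2 : 0 <= (1 - a i) / 2 by lra.
have := ler_wpM2l p1 h1; have := ler_wpM2l p2 h2; lra.
Qed.

Lemma rV_coord_le (v : 'rV[R]_m) j : `|v 0 j| <= `|v|.
Proof.
by rewrite [leRHS]/Num.norm/= mx_normrE; apply/bigmax_geP; right => /=; exists (0, j).
Qed.

Lemma concave_ge_on_ball x :
  exists M, forall w : 'rV[R]_m, `|w| <= 1 -> M <= f (x + w).
Proof.
have [M hM] := concave_ge_on_box (index_enum 'I_m) (fun j => delta_mx 0 j) x.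
exists M => w w1; rewrite [w]row_sum_delta.
by apply: hM => j; exact: le_trans (rV_coord_le w j) w1.
Qed.

Lemma concave_le_affine x :
  exists2 L, 0 <= L & forall y, f y <= f x + L * `|y - x|.
Proof.
have [M hM] := concave_ge_on_ball x.
have Mx : M <= f x by rewrite -[x]addr0; apply: hM; rewrite normr0 ler01.
exists (f x - M) => [|y]; first by rewrite subr_ge0.
have [->|yx] := eqVneq y x; first by rewrite subrr normr0 mulr0 addr0.
have d0 : 0 < `|y - x| by rewrite normr_gt0 subr_eq0.
set d := `|y - x| in d0 *.
have hw : M <= f (x + (- d^-1) *: (y - x)).
  apply: hM; rewrite normrZ normrN normfV (gtr0_norm d0) -/d.
  by rewrite mulVf// gt_eqF.
set w := x + _ in hw.
have d1 : 0 < 1 + d by lra.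
have xE : x = (1 / (1 + d)) *: y + (d / (1 + d)) *: w.
  apply/rowP => j; rewrite /w !mxE; field.
  by rewrite !gt_eqF.
have := @concave_functionE _ _ setT f (1 / (1 + d)) (d / (1 + d)) y w cf I I.
rewrite -xE => /(_ _ _ _)/wrap[].
- by rewrite divr_ge0// ltW.
- by rewrite divr_ge0// ltW.
- by field; rewrite gt_eqF.
have -> : 1 / (1 + d) * f y + d / (1 + d) * f w = (f y + d * f w) / (1 + d).
  by field; rewrite gt_eqF.
rewrite ler_pdivrMr// => h.
have := ler_wpM2l (ltW d0) hw; lra.
Qed.

Lemma closed_concave_superlevel y : closed [set x | y <= f x].
Proof.
move=> x xcl /=; apply/ler_addgt0Pr => e e0.
have [L L0 hL] := concave_le_affine x.
have L1 : 0 < L + 1 by lra.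
have [|z [/= yz xz]] := xcl (ball x (e / (L + 1))).
  by apply: nbhsx_ballx; rewrite divr_gt0.
apply: le_trans yz (le_trans (hL z) _); rewrite lerD2l.
move: xz; rewrite -ball_normE/= distrC ltr_pdivlMr// => h.
have := normr_ge0 (z - x); lra.
Qed.

End concave_rV.

Section norm_rV.
Variables (R : realType) (m : nat) (nm : 'rV[R]_m -> R).
Hypothesis hnm : is_norm nm.

Lemma is_norm0 : nm 0 = 0.
Proof. by rewrite -(scale0r 0) (is_norm_homogeneous hnm) normr0 mul0r. Qed.

Lemma is_normN v : nm (- v) = nm v.
Proof. by rewrite -scaleN1r (is_norm_homogeneous hnm) normrN1 mul1r. Qed.

Lemma is_norm_ge0 v : 0 <= nm v.
Proof.
have := is_norm_triangle hnm v (- v); rewrite subrr is_norm0 is_normN; lra.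
Qed.

Lemma is_norm_le_sup_norm : exists2 B, 0 <= B & forall v, nm v <= B * `|v|.
Proof.
exists (\sum_(j < m) nm (delta_mx 0 j)) => [|v].
  by apply: sumr_ge0 => j _; exact: is_norm_ge0.
rewrite {1}[v]row_sum_delta mulr_suml.
elim/big_ind2 : _ => [|a b c d ab cd|j _].
- by rewrite is_norm0.
- exact: le_trans (is_norm_triangle hnm _ _) (lerD ab cd).
- rewrite (is_norm_homogeneous hnm) mulrC ler_wpM2l ?is_norm_ge0//.
  exact: rV_coord_le.
Qed.

Lemma is_norm_continuous : continuous nm.
Proof.
have [B B0 hB] := is_norm_le_sup_norm.
move=> x; apply/(@cvgrPdist_le _ _ _ _ (nbhs_filter x)) => e e0.
have B1 : 0 < B + 1 by lra.
have : nbhs x (ball x (e / (B + 1))) by apply: nbhsx_ballx; rewrite divr_gt0.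
apply: filterS => z; rewrite -ball_normE/= ltr_pdivlMr// => h.
have h1 := is_norm_triangle hnm (x - z) z.
have h2 := is_norm_triangle hnm (z - x) x.
rewrite !subrK in h1 h2.
have h3 := hB (x - z).
have : nm (z - x) <= B * `|x - z| by rewrite -distrC.
have := normr_ge0 (x - z).
by rewrite ler_norml => ? ?; apply/andP; split; lra.
Qed.

Lemma sup_norm_le_is_norm : exists2 B, 0 <= B & forall v, `|v| <= B * nm v.
Proof.
pose S := [set v : 'rV[R]_m | `|v| = 1].
have [v0 | S0] := pselect (forall v : 'rV[R]_m, v = 0).
  by exists 0 => // v; rewrite mul0r (v0 v) normr0.
have Sn0 : S !=set0.
  move/existsNP : S0 => [v /eqP v0]; exists (`|v|^-1 *: v).
  by rewrite /S/= normrZ normfV normr_id mulVf// normr_eq0.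
have Scpt : compact S.
  apply: bounded_closed_compact.
    exists 1; split=> // t t1 v /= ->; exact: ltW.
  have -> : S = (@Num.norm _ _) @^-1` [set 1 : R] by [].
  by apply: preimage_closed; [move=> v _; exact: norm_continuous|exact: closed_eq].
have [u /set_mem Su umin] := compact_EVT_min Sn0 Scpt
  (continuous_subspaceT is_norm_continuous).
have nu : 0 < nm u.
  rewrite lt_neqAle is_norm_ge0 andbT eq_sym; apply/eqP => /(is_norm_definite hnm) u0.
  by move: Su; rewrite /S/= u0 normr0 => /esym/eqP; rewrite oner_eq0.
exists (nm u)^-1 => [|v]; first by rewrite invr_ge0 ltW.
have [->|v0] := eqVneq v 0; first by rewrite normr0 is_norm0 mulr0.
have v0' : 0 < `|v| by rewrite normr_gt0.
have := umin (`|v|^-1 *: v); rewrite (is_norm_homogeneous hnm) normfV normr_id.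
move=> /(_ _)/wrap[|h].
  by apply: mem_set; rewrite /S/= normrZ normfV normr_id mulVf// gt_eqF.
by rewrite mulrC ler_pdivlMr//; move: h; rewrite mulrC ler_pdivlMr// mulrC.
Qed.

End norm_rV.

Lemma powR_le_linear (R : realType) (r e : R) : 0 <= r < 1 -> 0 < e ->
  exists2 M, 0 <= M & forall t, 0 <= t -> t `^ r <= M + e * t.
Proof.
move=> /andP[r0 r1] e0; pose T := e `^ (r - 1)^-1.
have T0 : 0 < T by exact: powR_gt0.
exists (T `^ r) => [|t t0]; first exact: powR_ge0.
have [tT|Tt] := leP t T.
  rewrite -[leLHS]addr0 lerD// ?mulr_ge0 ?(ltW e0)//.
  by apply: ge0_ler_powR => //; rewrite nnegrE// ltW.
have tp : 0 < t by exact: lt_trans Tt.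
apply: (@le_trans _ _ (e * t)); last by rewrite lerDr powR_ge0.
have -> : e = (T `^ (1 - r))^-1.
  rewrite /T -powRrM -powRN -mulrN opprB mulVf ?powRr1 ?ltW//.
  by rewrite subr_eq0 lt_eqF.
rewrite mulrC ler_pdivlMr ?powR_gt0//.
have tE : t `^ r * t `^ (1 - r) = t.
  rewrite -powRD; last by rewrite addrCA subrr addr0 oner_eq0.
  by rewrite addrCA subrr addr0 powRr1 ?ltW.
rewrite -[leRHS]tE ler_wpM2l ?powR_ge0//.
by apply: ge0_ler_powR; rewrite ?nnegrE ?ltW// subr_gt0.
Qed.

Section attainment.
Variables (R : realType) (T : normedModType R).
Variables (Z : set T) (C : T -> R) (z0 : T).
Hypothesis Zz0 : Z z0.
Hypothesis C_ge0 : forall z, Z z -> 0 <= C z.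
Hypothesis C_sublevel : forall t, compact [set z | Z z /\ C z <= t].

Definition usc_sublinear (f : T -> R) :=
  (forall y, closed [set z | y <= f z]) /\
  forall e, 0 < e -> exists M, forall z, Z z -> f z <= M + e * C z.

(* The triples (a, s, y) with y at most the perspective a * phi (s / a) of
   phi t = max {f z | C z <= t}; sublinearity of f makes the value at a = 0
   equal to 0, which is what a = 0 gives here. *)
Definition perspective_hypograph (f : T -> R) : set (R * R * R) :=
  [set q | 0 <= q.1.1 /\
     exists z, [/\ Z z, q.1.1 * C z <= q.1.2 & q.2 <= q.1.1 * f z]].

Lemma closed_sublevel t : closed [set z | Z z /\ C z <= t].
Proof. by apply: compact_closed => //; exact: norm_hausdorff. Qed.

Lemma closed_le_continuous (U : topologicalType) (g h : U -> R) :
  continuous g -> continuous h -> closed [set u | g u <= h u].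
Proof.
move=> cg ch.
have -> : [set u | g u <= h u] = (h \- g) @^-1` [set y | 0 <= y].
  by apply/seteqP; split=> u /=; rewrite subr_ge0.
apply: preimage_closed; last exact: closed_ge.
by move=> u _; apply: continuousB; [exact: ch|exact: cg].
Qed.

Lemma closed_perspective_hypograph f :
  usc_sublinear f -> closed (perspective_hypograph f).
Proof.
move=> [f_usc f_sub] [[a s] y] qcl.
have fst_cont : continuous (fun q : R * R * R => q.1.1).
  by move=> q; apply: continuous_comp; exact: cvg_fst.
have snd_cont : continuous (fun q : R * R * R => q.1.2).
  by move=> q; apply: continuous_comp; [exact: cvg_fst|exact: cvg_snd].
have val_cont : continuous (fun q : R * R * R => q.2) by move=> q; exact: cvg_snd.
have rescale (q0 : R * R * R) (h : R * R * R -> R) : 0 < q0.1.1 ->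
    continuous h -> q0.1.1 / q.1.1 * h q @[q --> q0] --> h q0.
  move=> q0_gt0 ch; rewrite -[X in _ --> X]mul1r -(@divff _ q0.1.1) ?gt_eqF//.
  apply: cvgM; last exact: ch.
  apply: cvgM; first exact: cvg_cst.
  by apply: cvgV; [rewrite gt_eqF|exact: fst_cont].
have in_closed (g h : R * R * R -> R) : continuous g -> continuous h ->
    (forall q, perspective_hypograph f q -> g q <= h q) ->
    g (a, s, y) <= h (a, s, y).
  move=> cg ch gh; have gh_cl := closed_le_continuous cg ch.
  by apply: (gh_cl (a, s, y)); exact: closureS qcl.
have a0 : 0 <= a.
  apply: (in_closed (fun=> 0) (fun q => q.1.1)) => //; first exact: cst_continuous.
  by move=> q [].
have s0 : 0 <= s.
  apply: (in_closed (fun=> 0) (fun q => q.1.2)) => //; first exact: cst_continuous.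
  move=> q [q0 [z [Zz qz _]]]; apply: le_trans qz.
  by rewrite mulr_ge0// C_ge0.
split=> //=; move: a0; rewrite le_eqVlt => /predU1P[aE|a0].
  exists z0; rewrite -aE !mul0r; split=> //.
  rewrite -[leRHS]add0r; apply/ler_addgt0Pr => e e0.
  have s1 : 0 < s + 1 by lra.
  have e1 : 0 < e / (s + 1) by rewrite divr_gt0.
  have [M hM] := f_sub _ e1.
  have : y <= a * M + e / (s + 1) * s.
    apply: (in_closed (fun q => q.2) (fun q => q.1.1 * M + e / (s + 1) * q.1.2)).
    - exact: val_cont.
    - move=> q; apply: cvgD; apply: cvgM;
        [exact: fst_cont|exact: cvg_cst|exact: cvg_cst|exact: snd_cont].
    - move=> q [q0 [z [Zz qs qy]]]; apply: le_trans qy _.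
      have := ler_wpM2l q0 (hM _ Zz); have := ler_wpM2l (ltW e1) qs; lra.
  move/le_trans; apply; rewrite -aE mul0r !add0r.
  rewrite mulrAC ler_pdivrMr//; nra.
pose K e := [set z | [/\ Z z, a * C z <= s + e & y - e <= a * f z]].
have K_neq0 e : 0 < e -> K e !=set0.
  move=> e0.
  have near_s : \forall q \near (a, s, y), a / q.1.1 * q.1.2 < s + e.
    by apply: (cvgr_lt _ (rescale (a, s, y) _ a0 snd_cont)) => /=; lra.
  have near_y : \forall q \near (a, s, y), y - e < a / q.1.1 * q.2.
    by apply: (cvgr_gt _ (rescale (a, s, y) _ a0 val_cont)) => /=; lra.
  have near_a : \forall q \near (a, s, y), 0 < q.1.1.
    exact: (cvgr_gt _ (fst_cont (a, s, y))).
  have [q [[_ [z [Zz qs qy]]] [[hs hy] ha]]] :=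
    qcl _ (filterI (filterI near_s near_y) near_a).
  have aq0 : 0 <= a / q.1.1 by rewrite divr_ge0// ltW.
  have aqE u : a / q.1.1 * (q.1.1 * u) = a * u.
    by rewrite mulrA divfK// gt_eqF.
  exists z; split=> //.
    by rewrite -aqE; exact: le_trans (ler_wpM2l aq0 qs) (ltW hs).
  by rewrite -aqE; exact: le_trans (ltW hy) (ler_wpM2l aq0 qy).
pose F := filter_from [set e : R | 0 < e] K.
have FF : ProperFilter F.
  apply: filter_from_proper; last by move=> e; exact: K_neq0.
  apply: filter_from_filter; first by exists 1; rewrite /= ltr01.
  move=> e1 e2 /= e10 e20; exists (Num.min e1 e2); first by rewrite /= lt_min e10.
  move=> z [Zz cz fz]; have h1 : Num.min e1 e2 <= e1 by rewrite ge_min lexx.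
  have h2 : Num.min e1 e2 <= e2 by rewrite ge_min lexx orbT.
  by split; split=> //; lra.
have [|z [[Zz _] zF]] := C_sublevel (t := (s + 1) / a) FF.
  exists 1; first by rewrite /= ltr01.
  by move=> z [Zz cz _]; split=> //; rewrite ler_pdivlMr// mulrC.
have z_closed (B : set T) e : 0 < e -> closed B -> K e `<=` B -> B z.
  move=> e0 clB KB; apply: clB => V zV; apply: zF => //.
  by exists e.
exists z; split=> //; apply/ler_addgt0Pr => e e0.
  rewrite mulrC -ler_pdivlMr//.
  suff [] : [set z | Z z /\ C z <= (s + e) / a] z by [].
  apply: (z_closed _ e e0 (@closed_sublevel _)).
  by move=> u [Zu cu _]; split=> //; rewrite ler_pdivlMr// mulrC.
rewrite -lerBlDr mulrC -ler_pdivrMr//.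
apply: (z_closed _ e e0 (f_usc ((y - e) / a))).
by move=> u [Zu _ fu] /=; rewrite ler_pdivrMr// mulrC.
Qed.

Lemma perspective_pair_max (f g : T -> R) b : C z0 = 0 -> 0 <= b ->
  usc_sublinear f -> usc_sublinear g ->
  exists a s z1 z2, [/\ 0 <= a <= 1, 0 <= s <= b, Z z1 /\ Z z2,
      a * C z1 <= s /\ (1 - a) * C z2 <= b - s &
      forall a' s' z1' z2', 0 <= a' <= 1 -> 0 <= s' <= b -> Z z1' -> Z z2' ->
        a' * C z1' <= s' -> (1 - a') * C z2' <= b - s' ->
        a' * f z1' + (1 - a') * g z2' <= a * f z1 + (1 - a) * g z2].
Proof.
move=> Cz0 b0 hf hg.
have [Mf hMf] := hf.2 1 ltr01; have [Mg hMg] := hg.2 1 ltr01.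
pose M := `|Mf| + `|Mg| + b.
have le_M h Mh a s z : 0 <= a <= 1 -> s <= b -> Z z -> a * C z <= s ->
    (forall z, Z z -> h z <= Mh + 1 * C z) -> Mh <= `|Mf| + `|Mg| ->
    a * h z <= M.
  move=> /andP[a0 a1] sb Zz cz hh MhM.
  have N0 : 0 <= `|Mf| + `|Mg| by rewrite addr_ge0.
  have := ler_wpM2l a0 (hh z Zz); have := ler_wpM2l a0 MhM.
  have := ler_wpM2r N0 a1; rewrite /M; lra.
have Mf_le : Mf <= `|Mf| + `|Mg| by rewrite ler_wpDr// ler_norm.
have Mg_le : Mg <= `|Mf| + `|Mg| by rewrite ler_wpDl// ler_norm.
pose v0 := g z0.
pose box := (`[0, 1]%classic `*` `[0, b]%classic) `*`
  (`[v0 - M, M]%classic `*` `[v0 - M, M]%classic) : set (R * R * (R * R)).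
pose p1 (w : R * R * (R * R)) : R * R * R := (w.1.1, w.1.2, w.2.1).
pose p2 (w : R * R * (R * R)) : R * R * R := (1 - w.1.1, b - w.1.2, w.2.2).
have c11 : continuous (fun w : R * R * (R * R) => w.1.1).
  by move=> q; apply: continuous_comp; exact: cvg_fst.
have c12 : continuous (fun w : R * R * (R * R) => w.1.2).
  by move=> q; apply: continuous_comp; [exact: cvg_fst|exact: cvg_snd].
have c21 : continuous (fun w : R * R * (R * R) => w.2.1).
  by move=> q; apply: continuous_comp; [exact: cvg_snd|exact: cvg_fst].
have c22 : continuous (fun w : R * R * (R * R) => w.2.2).
  by move=> q; apply: continuous_comp; exact: cvg_snd.
have p1_cont : continuous p1.
  by move=> w; exact: cvg_pair (cvg_pair (c11 w) (c12 w)) (c21 w).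
have p2_cont : continuous p2.
  move=> w; apply: cvg_pair (cvg_pair _ _) (c22 w).
    exact: cvgB (cvg_cst _) (c11 w).
  exact: cvgB (cvg_cst _) (c12 w).
pose W := box `&` (p1 @^-1` perspective_hypograph f `&`
                   p2 @^-1` perspective_hypograph g).
have W_compact : compact W.
  have box_cpt : compact box.
    by apply: compact_setX; apply: compact_setX; exact: segment_compact.
  apply: (subclosed_compact _ box_cpt); last exact: subIsetl.
  apply: closedI.
    apply: compact_closed box_cpt.
    exact: (@norm_hausdorff R (R^o * R^o * (R^o * R^o))%type).
  by apply: closedI; apply: preimage_closed => [w _|];
    [exact: p1_cont|exact: closed_perspective_hypograph|
     exact: p2_cont|exact: closed_perspective_hypograph].
have in_W a' s' z1 z2 : 0 <= a' <= 1 -> 0 <= s' <= b -> Z z1 -> Z z2 ->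
    a' * C z1 <= s' -> (1 - a') * C z2 <= b - s' ->
    v0 <= a' * f z1 + (1 - a') * g z2 ->
    W ((a', s'), (a' * f z1, (1 - a') * g z2)).
  move=> a01 s0b Z1 Z2 c1 c2 v0le.
  have /andP[a0 a1] := a01; have /andP[s0 sb] := s0b.
  have h1 := le_M _ _ _ _ _ a01 sb Z1 c1 hMf Mf_le.
  have a01' : 0 <= 1 - a' <= 1 by lra.
  have sb' : b - s' <= b by lra.
  have h2 := le_M _ _ _ _ _ a01' sb' Z2 c2 hMg Mg_le.
  split.
    by split=> /=; split; rewrite /= in_itv/=; apply/andP; split; lra.
  by split; split=> /=; [lra|exists z1|lra|exists z2].
have W0 : W ((0, 0), (0 * f z0, (1 - 0) * g z0)).
  by apply: in_W => //; rewrite ?Cz0 ?lexx ?ler01//=; rewrite /v0; lra.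
have [||w /set_mem [wbox [[_ [z1 [Z1 c1 y1]]] [_ [z2 [Z2 c2 y2]]]]] wmax] :=
  @compact_EVT_max _ R (fun w => w.2.1 + w.2.2) W _ W_compact.
- by exists ((0, 0), (0 * f z0, (1 - 0) * g z0)).
- by apply: continuous_subspaceT => u; apply: cvgD; [exact: c21|exact: c22].
case: wbox => -[]/=; rewrite !in_itv/= => wa ws _.
exists w.1.1, w.1.2, z1, z2; split=> // a' s' z1' z2' a01 s0b Z1' Z2' c1' c2'.
have wle : w.2.1 + w.2.2 <= w.1.1 * f z1 + (1 - w.1.1) * g z2 by exact: lerD.
apply: le_trans wle; have [v0le|v0gt] := leP v0 (a' * f z1' + (1 - a') * g z2').
  exact: wmax (mem_set (in_W _ _ _ _ a01 s0b Z1' Z2' c1' c2' v0le)).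
apply: le_trans (ltW v0gt) _; have := wmax _ (mem_set W0).
by rewrite /= /v0; lra.
Qed.

End attainment.

Lemma is_max_sup (R : realType) (S : set R) (v : R) : is_max S v -> sup S = v.
Proof.
move=> [Sv Subd]; apply/eqP; rewrite eq_le; apply/andP; split.
  by apply: ge_sup => //; exists v.
by apply: ub_le_sup => //; exists v.
Qed.

Lemma le_1DpowR (R : realType) (u p : R) : 0 <= u -> 1 <= p -> u <= 1 + u `^ p.
Proof.
move=> u0 p1; have [u1|u1] := leP u 1.
  by rewrite -[leLHS]addr0 lerD// powR_ge0.
by apply: le_trans (le1r_powR (ltW u1) p1) _; rewrite lerDr.
Qed.

Section from_regularity.
Variables (R : realType) (n m K N : nat).
Variables (X : set 'rV[R]_n) (Z : set 'rV[R]_m).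
Variables (c : 'rV[R]_m -> 'rV[R]_m -> R).
Variables (ell : 'I_K -> 'rV[R]_n -> 'rV[R]_m -> R).
Variables (zhat : 'I_N -> 'rV[R]_m) (rho : R).
Hypothesis hc : transportation_cost Z c.
Hypothesis hreg : regularity X Z c zhat rho ell.

Lemma cost_sublevel_compact zh t : Z zh -> compact [set z | Z z /\ c z zh <= t].
Proof.
move=> Zzh; apply: bounded_closed_compact.
  have [nm [p [hnm p1 hgrowth _]]] := cost_growth hreg.
  have [B B0 hB] := sup_norm_le_is_norm hnm.
  exists (B * (1 + t) + `|zh|); split; first exact: num_real.
  move=> M /ltW hM z [Zz cz]; apply: le_trans hM.
  rewrite -[z in leLHS](subrK zh); apply: le_trans (ler_normD _ _) _.
  rewrite lerD2r; apply: le_trans (hB _) _; rewrite ler_wpM2l//.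
  apply: le_trans (le_1DpowR (is_norm_ge0 hnm _) p1) _.
  by rewrite lerD2l; apply: le_trans cz; exact: hgrowth.
move=> z zcl.
have Zz : Z z.
  by apply: (Z_closed hreg); apply: closureS zcl => u [].
split=> //; rewrite leNgt; apply/negP => tc.
have lsc := cost_lsc hc; have [V zV hV] := lsc (z, zh) t tc.
have {}zV : within (Z `*` Z) (nbhs (z, zh)) V by rewrite nbhs_subspace_in.
have pair_cont : (u, zh) @[u --> z] --> (z, zh).
  exact: (@cvg_pair _ _ _ (nbhs z) (nbhs z) (nbhs zh) _ _ _ id (cst zh)
    cvg_id (cvg_cst zh)).
have {}zV := pair_cont _ zV.
have [u [[Zu cu] /= hu]] := zcl _ zV.
have := hV _ (hu (conj Zu Zzh)); rewrite lte_fin /=.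
by rewrite ltNge cu.
Qed.

Lemma le_loss k x z : ell k x z <= loss ell x z.
Proof.
apply: ub_le_sup; last by exists k.
exists (\sum_j `|ell j x z|) => _ [j _ <-].
by rewrite (bigD1 j)//= ler_wpDr ?sumr_ge0// ler_norm.
Qed.

Lemma ell_usc_sublinear zh k x : Z zh -> X x ->
  usc_sublinear Z (c^~ zh) (ell k x).
Proof.
move=> Zzh Xx; split; first exact: closed_concave_superlevel (ell_concave hreg k x).
move=> e e0; have [nm [p [hnm p1 hgrowth hlin]]] := cost_growth hreg.
have nm0 := is_norm_ge0 hnm.
have [pE|pN1] := eqVneq p 1.
  have [g [zh0 [r [g0 Zzh0 r01 hl]]]] := hlin pE x Xx.
  have eg : 0 < e / g by rewrite divr_gt0.
  have [M M0 hM] := powR_le_linear r01 eg.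
  exists (g * (1 + M) + e * nm (zh - zh0)) => z Zz.
  apply: le_trans (le_loss _ _ _) (le_trans (hl z Zz) _).
  have h1 := ler_wpM2l (ltW g0) (hM _ (nm0 (z - zh0))).
  have h2 : nm (z - zh0) <= nm (z - zh) + nm (zh - zh0).
    by rewrite -[z - zh0](subrKA zh); exact: is_norm_triangle.
  have h3 : nm (z - zh) <= c z zh.
    by have := hgrowth z zh Zz Zzh; rewrite pE powRr1.
  have h4 : e * nm (z - zh0) <= e * (c z zh + nm (zh - zh0)).
    by rewrite ler_wpM2l ?(ltW e0)//; lra.
  have h5 : g * (e / g * nm (z - zh0)) = e * nm (z - zh0).
    by rewrite mulrA mulrCA divff ?gt_eqF// mulr1.
  lra.
have pgt1 : 1 < p by rewrite lt_neqAle eq_sym pN1.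
have p0 : 0 < p by lra.
have [L L0 hL] := concave_le_affine (ell_concave hreg k x) zh.
have [B B0 hB] := sup_norm_le_is_norm hnm.
have LB0 : 0 <= L * B by rewrite mulr_ge0.
have e'0 : 0 < e / (L * B + 1) by rewrite divr_gt0//; lra.
have r01 : 0 <= p^-1 < 1 by rewrite invr_ge0 (ltW p0)/= invf_lt1.
have [M M0 hM] := powR_le_linear r01 e'0.
exists (ell k x zh + L * B * M) => z Zz.
apply: le_trans (hL z) _; rewrite -addrA lerD2l.
have h1 : L * `|z - zh| <= L * B * nm (z - zh).
  by rewrite -mulrA ler_wpM2l.
have h2 : nm (z - zh) <= M + e / (L * B + 1) * nm (z - zh) `^ p.
  have := hM _ (powR_ge0 (nm (z - zh)) p).
  by rewrite -powRrM divff ?gt_eqF// powRr1.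
have h3 := ler_wpM2l LB0 h2.
have cz0 : 0 <= c z zh by exact: cost_ge0 hc _ _ Zz Zzh.
have h4 : e / (L * B + 1) * nm (z - zh) `^ p <= e / (L * B + 1) * c z zh.
  by rewrite ler_wpM2l ?(ltW e'0)//; exact: hgrowth.
have h5 := ler_wpM2l LB0 h4.
have h6 : L * B * (e / (L * B + 1) * c z zh) <= e * c z zh.
  have -> : L * B * (e / (L * B + 1) * c z zh) =
      (L * B / (L * B + 1)) * (e * c z zh).
    by field; rewrite gt_eqF//; lra.
  rewrite -[leRHS]mul1r ler_wpM2r ?mulr_ge0 ?(ltW e0)//.
  by rewrite ler_pdivrMr; lra.
lra.
Qed.

End from_regularity.

Section local_utility.
Variables (R : realType) (m K : nat).
Variables (Z : set 'rV[R]_m) (c : 'rV[R]_m -> 'rV[R]_m -> R).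
Variables (f : 'I_K -> 'rV[R]_m -> R) (zh : 'rV[R]_m).
Hypothesis hc : transportation_cost Z c.
Hypothesis Zzh : Z zh.

Lemma pair_valuesP k1 k2 b s : pair_values Z c f zh k1 k2 b s <->
  exists a t z1 z2, [/\ 0 <= a <= 1, 0 <= t <= b, Z z1 /\ Z z2,
    a * c z1 zh <= t /\ (1 - a) * c z2 zh <= b - t &
    s = a * f k1 z1 + (1 - a) * f k2 z2].
Proof.
split=> [[a1 [a2 [b1 [b2 [v1 [v2 [[a10 a20 b10 b20] [Z1 Z2] [c1 c2] [aE bE] sE]]]]]]]|].
  have a2E : a2 = 1 - a1 by lra.
  have b2E : b2 = b - b1 by lra.
  exists a1, b1, (zh + v1), (zh + v2); rewrite -a2E -b2E.
  by split=> //; apply/andP; split; lra.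
move=> [a [t [z1 [z2 [/andP[a0 a1] /andP[t0 tb] [Z1 Z2] [c1 c2] sE]]]]].
exists a, (1 - a), t, (b - t), (z1 - zh), (z2 - zh).
have zhK z : zh + (z - zh) = z by rewrite addrC subrK.
by rewrite !zhK; split=> //; split; lra.
Qed.

Hypothesis f_usc : forall k, usc_sublinear Z (c^~ zh) (f k).
Hypothesis c_sublevel : forall t, compact [set z | Z z /\ c z zh <= t].

Lemma pair_utility_is_max k1 k2 b : 0 <= b ->
  is_max (pair_values Z c f zh k1 k2 b) (pair_utility Z c f zh k1 k2 b).
Proof.
move=> b0.
have [a [t [z1 [z2 [a01 tb Z12 c12 zmax]]]]] :=
  perspective_pair_max Zzh (fun z Zz => cost_ge0 hc Zz Zzh) c_sublevel
    (cost_refl hc Zzh) b0 (f_usc k1) (f_usc k2).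
have vmax : is_max (pair_values Z c f zh k1 k2 b)
    (a * f k1 z1 + (1 - a) * f k2 z2).
  split; first by apply/pair_valuesP; exists a, t, z1, z2.
  move=> _ /pair_valuesP[a' [t' [z1' [z2' [a01' tb' [Z1 Z2] [c1 c2] ->]]]]].
  exact: zmax Z1 Z2 c1 c2.
by rewrite /pair_utility (is_max_sup vmax).
Qed.

Lemma pair_utility_le_local (k1 k2 : 'I_K) b : (k1 < k2)%N ->
  pair_utility Z c f zh k1 k2 b <= local_utility Z c f zh b.
Proof.
move=> k12; apply: ub_le_sup; last by exists k1, k2.
exists (\sum_(p : 'I_K * 'I_K) `|pair_utility Z c f zh p.1 p.2 b|).
move=> _ [j1 [j2 [_ ->]]].
by rewrite (bigD1 (j1, j2))//= ler_wpDr ?sumr_ge0// ler_norm.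
Qed.

Lemma local_utility_attained b : (2 <= K)%N ->
  exists k1 k2 : 'I_K, (k1 < k2)%N /\
    local_utility Z c f zh b = pair_utility Z c f zh k1 k2 b.
Proof.
move=> K2; pose i0 := (Ordinal (ltnW K2), Ordinal K2).
have [//|[j1 j2] /= j12 jmax] := @arg_maxP _ _ _ i0
  (fun p => (p.1 < p.2)%N) (fun p => pair_utility Z c f zh p.1 p.2 b).
exists j1, j2; split=> //; apply: is_max_sup; split; first by exists j1, j2.
by move=> _ [k1 [k2 [k12 ->]]]; exact: (jmax (k1, k2)).
Qed.

Definition atoms : set (R * R) :=
  [set P | exists k z, [/\ Z z, P.1 = c z zh & P.2 = f k z]].

Lemma local_utility_atoms b : (2 <= K)%N -> 0 <= b ->
  exists P Q a, [/\ atoms P, atoms Q, 0 <= a <= 1,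
    a * P.1 + (1 - a) * Q.1 <= b &
    local_utility Z c f zh b = a * P.2 + (1 - a) * Q.2].
Proof.
move=> K2 b0; have [k1 [k2 [k12 ->]]] := local_utility_attained b K2.
have [/pair_valuesP[a [t [z1 [z2 [a01 tb [Z1 Z2] [c1 c2] sE]]]]] _] :=
  pair_utility_is_max k1 k2 b0.
exists (c z1 zh, f k1 z1), (c z2 zh, f k2 z2), a; split=> //=.
- by exists k1, z1.
- by exists k2, z2.
- lra.
Qed.

Lemma pair_le_local_utility (k1 k2 : 'I_K) z1 z2 a b : (k1 < k2)%N ->
  Z z1 -> Z z2 -> 0 <= a <= 1 -> a * c z1 zh + (1 - a) * c z2 zh <= b ->
  a * f k1 z1 + (1 - a) * f k2 z2 <= local_utility Z c f zh b.
Proof.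
move=> k12 Z1 Z2 a01 cb; apply: le_trans (pair_utility_le_local b k12).
have /andP[a0 a1] := a01.
have c10 : 0 <= a * c z1 zh by rewrite mulr_ge0// (cost_ge0 hc).
have c20 : 0 <= (1 - a) * c z2 zh by rewrite mulr_ge0 ?subr_ge0// (cost_ge0 hc).
have b0 : 0 <= b by lra.
apply: (pair_utility_is_max k1 k2 b0).2; apply/pair_valuesP.
exists a, (a * c z1 zh), z1, z2; split=> //; [lra|split; lra].
Qed.

Hypothesis Z_conv : convex_set Z.
Hypothesis f_conc : forall k, concave_function setT (f k).

Lemma atoms_le_local_utility P Q a b : (2 <= K)%N -> atoms P -> atoms Q ->
  0 <= a <= 1 -> a * P.1 + (1 - a) * Q.1 <= b ->
  a * P.2 + (1 - a) * Q.2 <= local_utility Z c f zh b.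
Proof.
move=> K2 [k1 [z1 [Z1 -> ->]]] [k2 [z2 [Z2 -> ->]]] a01 cb.
have /andP[a0 a1] := a01.
have a1' : 0 <= 1 - a by lra.
have aE : a + (1 - a) = 1 by lra.
have [k12|k21|k12] := ltngtP k1 k2.
- exact: pair_le_local_utility.
- rewrite addrC -[a in a * f k1 z1](subKr 1).
  apply: pair_le_local_utility => //; [lra|].
  by rewrite subKr addrC.
(* Two atoms of the same piece merge by convexity; any other piece then gets
   weight zero. *)
have {k12} <- : k1 = k2 by exact: val_inj.
pose z := a *: z1 + (1 - a) *: z2.
have Zz : Z z by exact: convex_setE.
have cz : c z zh <= b.
  exact: le_trans (convex_functionE (cost_convex hc Zzh) Z1 Z2 a0 a1' aE) cb.
apply: le_trans (concave_functionE (f_conc k1) I I a0 a1' aE) _.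
rewrite -/z.
have [k k1k] : exists k : 'I_K, k != k1.
  have [->|] := eqVneq k1 (Ordinal K2); last by exists (Ordinal K2); rewrite eq_sym.
  by exists (Ordinal (ltnW K2)).
have [kk1|kk1|kk1] := ltngtP k k1.
- have := @pair_le_local_utility k k1 zh z 0 b kk1 Zzh Zz.
  rewrite !mul0r !add0r subr0 !mul1r; apply=> //.
  by rewrite lexx ler01.
- have := @pair_le_local_utility k1 k z zh 1 b kk1 Zz Zzh.
  rewrite subrr !mul0r !addr0 !mul1r; apply=> //.
  by rewrite lexx ler01.
- by move: k1k; rewrite (val_inj kk1) eqxx.
Qed.

Lemma local_utility_concave : (2 <= K)%N ->
  concave_function (`[0, +oo[%classic : set R^o) (local_utility Z c f zh).
Proof.
move=> K2 t x y /set_mem/=; rewrite in_itv/= andbT => x0.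
move=> /set_mem/=; rewrite in_itv/= andbT => y0.
have u01 : 0 <= (t%:num : R) <= 1 by apply/andP; split.
set u := (t%:num : R) in u01.
change (u * local_utility Z c f zh x + (1 - u) * local_utility Z c f zh y <=
  local_utility Z c f zh (u * x + (1 - u) * y)).
clearbody u; clear t; have /andP[u0 u1] := u01.
have [P1 [P2 [a [D1 D2 /andP[a0 a1] cx ->]]]] := local_utility_atoms K2 x0.
have [P3 [P4 [b [D3 D4 /andP[b0 b1] cy ->]]]] := local_utility_atoms K2 y0.
have w1 : 0 <= u * a by rewrite mulr_ge0.
have w2 : 0 <= u * (1 - a) by rewrite mulr_ge0 ?subr_ge0.
have w3 : 0 <= (1 - u) * b by rewrite mulr_ge0 ?subr_ge0.
have w4 : 0 <= (1 - u) * (1 - b) by rewrite mulr_ge0 ?subr_ge0.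
have [P [Q [p [q [[DP DQ p0 q0] pq pqc pqf]]]]] :=
  four_to_two_atoms D1 D2 D3 D4 w1 w2 w3 w4.
have qE : q = 1 - p by lra.
rewrite qE in q0 pqc pqf.
have cx' := ler_wpM2l u0 cx.
have cy' : (1 - u) * (b * P3.1 + (1 - b) * P4.1) <= (1 - u) * y.
  by rewrite ler_wpM2l ?subr_ge0.
apply: (@le_trans _ _ (p * P.2 + (1 - p) * Q.2)); first lra.
by apply: atoms_le_local_utility => //; [apply/andP; split; lra|lra].
Qed.

End local_utility.

Unset Implicit Arguments.

(* The first conjunct says that the suprema defining pair_utility are finite
   and attained, i.e. that they are maxima. *)
Theorem lemma11 (R : realType) (n m K N : nat)
    (X : set 'rV[R]_n) (Z : set 'rV[R]_m)
    (c : 'rV[R]_m -> 'rV[R]_m -> R)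
    (ell : 'I_K -> 'rV[R]_n -> 'rV[R]_m -> R)
    (zhat : 'I_N -> 'rV[R]_m) (rho : R)
    (hc : transportation_cost Z c)
    (hN : (0 < N)%N) (hzhat : forall i, Z (zhat i)) (hrho : 0 < rho)
    (hreg : regularity X Z c zhat rho ell)
    (x : 'rV[R]_n) (hx : X x)
    (horacle : local_worst_case_oracle Z c (fun k z => ell k x z))
    (i : 'I_N) :
  (forall (k1 k2 : 'I_K) (b : R), (k1 < k2)%N -> 0 <= b ->
     is_max (pair_values Z c (fun k z => ell k x z) (zhat i) k1 k2 b)
            (pair_utility Z c (fun k z => ell k x z) (zhat i) k1 k2 b)) /\
  concave_function (`[0, +oo[%classic : set R^o)
    (local_utility Z c (fun k z => ell k x z) (zhat i)).
Proof.
have hsub t := cost_sublevel_compact (t := t) hc hreg (hzhat i).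
have husc k := ell_usc_sublinear hc hreg k (hzhat i) hx.
split=> [k1 k2 b _ b0|]; first exact: (pair_utility_is_max hc).
exact: (local_utility_concave hc (hzhat i) husc hsub (Z_convex hreg)
  (fun k => ell_concave hreg k x) (K_ge2 hreg)).
Qed.
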